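(* Let $n\geq 1$ be an integer and let $X$ be any one of the Euclidean space $\mathbb{R}^n$, the spherical space $\mathbb{S}^n$ and the hyperbolic space $\mathbb{H}^n$, with its standard metric of constant curvature $0$, $1$ and $-1$, respectively. Then $\dim_k(X) = n+k$ for $k=1,2,\ldots$.
   Context: For a metric space $(X,d)$ and a positive integer $k$, a subset $S\subset X$ is a $k$-metric generator for $X$ if for any two distinct points $u,v\in X$ there are at least $k$ distinct points $w\in S$ with $d(u,w)\neq d(v,w)$. The $k$-metric dimension $\dim_k(X)$ is the infimum of $|S|$ over all $k$-metric generators $S$ for $X$ (with $|S|=+\infty$ for infinite $S$ and $\inf\varnothing=+\infty$). The space $\mathbb{R}^n$ carries the Euclidean metric; $\mathbb{S}^n=\{x\in\mathbb{R}^{n+1}:\|x\|=1\}$ carries the path metric $d$ with $\cos d(x,y)=x\cdot y$, $d(x,y)\in[0,\pi]$; $\mathbb{H}^n$ is $n$-dimensional hyperbolic space, e.g. the upper half-space $\{(x_1,\ldots,x_n)\in\mathbb{R}^n: x_n>0\}$ with the distance derived from the Riemannian metric $|dx|/x_n$. *)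

(* Defs.v *)
From mathcomp Require Import all_boot all_order all_algebra.
From mathcomp Require Import all_classical all_reals all_analysis.
Import Order.TTheory GRing.Theory Num.Theory.
Import numFieldNormedType.Exports.

Set Implicit Arguments.
Unset Strict Implicit.
Unset Printing Implicit Defensive.

Local Open Scope classical_set_scope.
Local Open Scope card_scope.
Local Open Scope ring_scope.

(* A space is given by its set of points X inside an ambient type T, together
   with its distance function d, of which only the values on X matter. *)

Definition kmetric_generator (R : realType) (T : choiceType) (X : set T)
    (d : T -> T -> R) (k : nat) (S : set T) : Prop :=
  S `<=` X /\
  forall u v, X u -> X v -> u <> v ->
    `I_k #<= [set w | S w /\ d u w <> d v w].

(* [counting S] is the number of elements of S, and +oo if S is infinite;
   [ereal_inf set0] is +oo. *)
Definition kmetric_dim (R : realType) (T : choiceType) (X : set T)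
    (d : T -> T -> R) (k : nat) : \bar R :=
  ereal_inf [set counting S | S in [set S | kmetric_generator X d k S]].

(* The library norm on 'rV[R]_n is the sup norm, hence an explicit Euclidean
   inner product and norm. *)
Definition dot (R : realType) (n : nat) (x y : 'rV[R]_n) : R :=
  \sum_(i < n) x ord0 i * y ord0 i.

Definition enorm (R : realType) (n : nat) (x : 'rV[R]_n) : R :=
  Num.sqrt (dot x x).

Definition euclidean_dist (R : realType) (n : nat) (x y : 'rV[R]_n) : R :=
  enorm (x - y).

Definition sphere (R : realType) (n : nat) : set 'rV[R]_n.+1 :=
  [set x | enorm x = 1].

Definition spherical_dist (R : realType) (n : nat) (x y : 'rV[R]_n.+1) : R :=
  acos (dot x y).

(* The last coordinate x_n; the value for n = 0 is a dummy. *)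
Definition height (R : realType) (n : nat) : 'rV[R]_n -> R :=
  match n with
  | 0 => fun=> 0
  | n'.+1 => fun x => x ord0 ord_max
  end.

Definition half_space (R : realType) (n : nat) : set 'rV[R]_n :=
  [set x | 0 < height x].

Definition velocity (R : realType) (n : nat) (g : R -> 'rV[R]_n) (t : R) :
    'rV[R]_n :=
  \row_i derive1 (fun s => g s ord0 i) t.

(* C^1 curves from x to y in the half-space, parametrized by [0, 1]. Asking for
   g to be C^1 on the whole of R (but in the half-space only over [0, 1]) is no
   restriction: a curve that is C^1 on [0, 1] up to the end points extends
   affinely. The velocity may vanish, so piecewise C^1 curves, reparametrized to
   stop at their corners, are covered too. *)
Definition half_space_curve (R : realType) (n : nat) (x y : 'rV[R]_n)
    (g : R -> 'rV[R]_n) : Prop :=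
  [/\ forall i t, derivable (fun s => g s ord0 i) t 1,
      forall i, continuous (fun t => velocity g t ord0 i),
      forall t, 0 <= t <= 1 -> half_space (g t),
      g 0 = x & g 1 = y].

(* Length for the Riemannian metric |dx| / x_n. *)
Definition hyperbolic_length (R : realType) (n : nat) (g : R -> 'rV[R]_n) : R :=
  Rintegral (@lebesgue_measure R) `[0, 1]
    (fun t => enorm (velocity g t) / height (g t)).

Definition hyperbolic_dist (R : realType) (n : nat) (x y : 'rV[R]_n) : R :=
  inf [set hyperbolic_length g | g in half_space_curve x y].

(* Main.v *)
(** A bisector {w | d(u,w) = d(v,w)} is the trace on X of a hyperplane of
R^(n+1), once X is suitably lifted: by w |-> (w, 1) for R^n, by the inclusion
for S^n, and by w |-> (w_1, ..., w_(n-1), |w|^2, 1) for the upper half-space.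
Conversely, the trace of a hyperplane which meets the lift of X is contained in
a bisector. Any n points of X lift into a hyperplane, so some
pair u <> v is told apart only by the other points of S, which gives
|S| >= n + k; points on a moment curve have the property that no n + 1 of them
lift into a hyperplane, so any n + k of them form a k-metric generator.

For H^n this needs the formula cosh d(x,y) = 1 + |x-y|^2 / (2 x_n y_n). With
D the value predicted for d(x,y) and X, Y the points of the hyperboloid
corresponding to x and y, the light-like vectors Y - exp(-D) X and
X - exp(-D) Y are the ends of the geodesic through x and y. The first one
defines a Busemann function, which is 1-Lipschitz and varies by D between x
and y; together they parametrize a curve of speed D from x to y. *)

Require Import Defs.
From mathcomp Require Import all_boot all_order all_algebra.
From mathcomp Require Import all_classical all_reals all_analysis.
From mathcomp Require Import ring lra.
Import Order.TTheory GRing.Theory Num.Theory.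
Import numFieldNormedType.Exports.

Set Implicit Arguments.
Unset Strict Implicit.
Unset Printing Implicit Defensive.

Local Open Scope classical_set_scope.
Local Open Scope ring_scope.

(** * Criteria for lower and upper bounds on the k-metric dimension *)

Section kmetric_dimension.
Variables (R : realType) (T : choiceType) (X : set T) (d : T -> T -> R).
Variables (n k : nat).

(** List a finite generator and apply the hypothesis to its first [n] points: the [k] points that
    tell [u] and [v] apart all lie in the rest of the list. The point [x0] pads lists that are too
    short. *)
Lemma kmetric_dim_ge (x0 : T) : X x0 -> (0 < k)%N ->
  (forall p : nat -> T, (forall j, X (p j)) ->
    exists u v, [/\ X u, X v, u <> v &
      forall j, (j < n)%N -> d u (p j) = d v (p j)]) ->
  ((n + k)%:R%:E <= kmetric_dim X d k)%E.
Proof.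
move=> Xx0 k0 equidist; apply: le_ereal_inf_tmp => _ [S [SX gen] <-].
rewrite /counting; case: asboolP => [finS|_]; last exact: leey.
set s := finmap.enum_fset (fset_set S).
have sS w : w \in s -> S w by rewrite in_fset_set// inE.
have [j|u [v [Xu Xv uv duv]]] := equidist (fun j => nth x0 s j).
  have [js|sj] := ltnP j (size s); last by rewrite nth_default.
  by apply/SX/sS/mem_nth.
have := gen u v Xu Xv uv; set A := (X in (_ #<= X)%card) => kA.
have finA : finite_set A by apply: (sub_finite_set _ finS) => w [].
have /leq_trans/(_ _) kn := leq_card_fset_set finA kA.
have : (k <= size (drop n s))%N.
  apply/kn/uniq_leq_size => [|w]; first exact: finmap.fset_uniq.
  rewrite in_fset_set// inE => -[Sw duvw].
  have ws : w \in s by rewrite in_fset_set// inE.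
  have := ws; rewrite -{1}(cat_take_drop n s) mem_cat => /orP[wn|//].
  case: duvw; rewrite -(nth_index x0 ws); apply: duv.
  rewrite -{1}(cat_take_drop n s) index_cat wn.
  by rewrite (leq_trans _ (geq_minl n (size s)))// -size_take_min index_mem.
(* The subtraction in [size_drop] is truncated; [0 < k] makes it a genuine one. *)
rewrite size_drop lee_fin ler_nat => ks.
by rewrite -leq_subRL// ltnW// -subn_gt0 (leq_trans k0).
Qed.

(** The first [n + k] terms of [w] form a generator: at most [n] of their indices fail to separate
    [u] from [v], so at least [k] do. Counting indices in lists prepares for root counting. *)
Lemma kmetric_dim_le (w : nat -> T) : (forall j, X (w j)) -> injective w ->
  (forall u v, X u -> X v -> u <> v -> forall I : seq nat, uniq I ->
    (forall j, j \in I -> d u (w j) = d v (w j)) -> (size I <= n)%N) ->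
  (kmetric_dim X d k <= (n + k)%:R%:E)%E.
Proof.
move=> Xw winj bisector; apply: ereal_inf_lbound.
have wI : (w @` `I_(n + k) #= `I_(n + k))%card by apply: inj_card_eq => ? ? _ _ /winj.
exists (w @` `I_(n + k)); last first.
  rewrite /counting (card_fset_set wI).
  by case: asboolP => // -[]; apply: finite_image; exact: finite_II.
split=> [_ [j _ <-]//|u v Xu Xv uv].
set P := fun j => `[< d u (w j) = d v (w j) >].
set s := iota 0 (n + k).
have sn : (size [seq j <- s | P j] <= n)%N.
  apply: (bisector u v) => //; first by rewrite filter_uniq// iota_uniq.
  by move=> j; rewrite mem_filter => /andP[/asboolP].
have sk : (k <= size [seq j <- s | predC P j])%N.
  have : (size [seq j <- s | P j] + size [seq j <- s | predC P j] = n + k)%N.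
    by rewrite !size_filter count_predC size_iota.
  by move=> h; rewrite -(leq_add2l n) -h leq_add2r.
set f := fun i => w (nth 0%N [seq j <- s | predC P j] i).
have fk : (f @` `I_k #= `I_k)%card.
  apply: inj_card_eq => i j /set_mem/= ik /set_mem/= jk /winj/eqP.
  rewrite nth_uniq ?(leq_trans _ sk)// ?filter_uniq ?iota_uniq//.
  by move/eqP.
rewrite -(card_le_eql fk); apply: subset_card_le => _ [i /= ik <-].
have : nth 0%N [seq j <- s | predC P j] i \in [seq j <- s | predC P j].
  by rewrite mem_nth// (leq_trans ik).
rewrite mem_filter mem_iota add0n => /andP[/asboolP ? /andP[_ ?]].
by split=> //; exists (nth 0%N [seq j <- s | predC P j] i).
Qed.

End kmetric_dimension.

(** * Euclidean inner product *)

Section dot_product.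
Variables (R : realType) (n : nat).
Implicit Types (x y z : 'rV[R]_n) (a : R).

Lemma dotC x y : dot x y = dot y x.
Proof. by apply: eq_bigr => i _; rewrite mulrC. Qed.

Lemma dotDl x y z : dot (x + y) z = dot x z + dot y z.
Proof. by rewrite -big_split; apply: eq_bigr => i _ /=; rewrite mxE mulrDl. Qed.

Lemma dotDr x y z : dot z (x + y) = dot z x + dot z y.
Proof. by rewrite dotC dotDl ![dot _ z]dotC. Qed.

Lemma dotZl a x y : dot (a *: x) y = a * dot x y.
Proof. by rewrite mulr_sumr; apply: eq_bigr => i _; rewrite mxE mulrA. Qed.

Lemma dotZr a x y : dot x (a *: y) = a * dot x y.
Proof. by rewrite dotC dotZl dotC. Qed.

Lemma dotNl x y : dot (- x) y = - dot x y.
Proof. by rewrite -scaleN1r dotZl mulN1r. Qed.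

Lemma dotNr x y : dot x (- y) = - dot x y.
Proof. by rewrite dotC dotNl dotC. Qed.

Lemma dot0l x : dot 0 x = 0.
Proof. by rewrite -(scale0r x) dotZl mul0r. Qed.

Lemma dot0r x : dot x 0 = 0.
Proof. by rewrite dotC dot0l. Qed.

Definition dotE := (dotDl, dotDr, dotZl, dotZr, dotNl, dotNr).

Lemma dot_ge0 x : 0 <= dot x x.
Proof. by apply: sumr_ge0 => i _; rewrite -expr2 sqr_ge0. Qed.

Lemma dot_eq0 x : (dot x x == 0) = (x == 0).
Proof.
apply/eqP/eqP => [/psumr_eq0P x0|->]; last by rewrite dot0l.
apply/rowP => i; have /eqP := x0 (fun i _ => sqr_ge0 _) i isT.
by rewrite mulf_eq0 orbb mxE => /eqP.
Qed.

Lemma cauchy_schwarz_dot x y : (dot x y) ^+ 2 <= dot x x * dot y y.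
Proof.
have [->|y0] := eqVneq y 0; first by rewrite !dot0r expr0n/= mulr0.
have yy : 0 < dot y y by rewrite lt0r dot_eq0 y0 dot_ge0.
(* This square equals [dot y y] times the difference of the two sides. *)
have := dot_ge0 (dot y y *: x - dot x y *: y); rewrite !dotE (dotC y x).
move=> h; rewrite -subr_ge0 -(pmulr_rge0 _ yy); apply: le_trans h _.
by rewrite le_eqVlt; apply/orP; left; apply/eqP; ring.
Qed.

Lemma enorm_sqr x : enorm x ^+ 2 = dot x x.
Proof. exact/sqr_sqrtr/dot_ge0. Qed.

Lemma euclidean_dist_eq x y z : euclidean_dist x z = euclidean_dist y z <->
  dot x x - dot y y - 2 * dot (x - y) z = 0.
Proof.
have e : dot x x - dot y y - 2 * dot (x - y) z =
    dot (x - z) (x - z) - dot (y - z) (y - z).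
  by rewrite !dotE (dotC z x) (dotC z y); ring.
rewrite e /euclidean_dist; split=> [h|/subr0_eq h].
  by rewrite -!enorm_sqr h subrr.
by rewrite /enorm h.
Qed.

End dot_product.

(** * Splitting off the last coordinate *)

Section last_coordinate.
Variables (R : realType) (m : nat).
Implicit Types (x y : 'rV[R]_m.+1) (p : 'rV[R]_m) (h : R).

Definition base x : 'rV[R]_m := \row_i x ord0 (lift ord_max i).

Definition snoc p h : 'rV[R]_m.+1 :=
  \row_i if unlift ord_max i is Some j then p ord0 j else h.

Lemma snoc_lift p h i : snoc p h ord0 (lift ord_max i) = p ord0 i.
Proof. by rewrite mxE liftK. Qed.

Lemma base_snoc p h : base (snoc p h) = p.
Proof. by apply/rowP => i; rewrite mxE snoc_lift. Qed.

Lemma height_snoc p h : height (snoc p h) = h.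
Proof. by rewrite /height mxE unlift_none. Qed.

Lemma snoc_base x : snoc (base x) (height x) = x.
Proof. by apply/rowP => i; rewrite mxE; case: unliftP => [j|] ->; rewrite ?mxE. Qed.

Lemma base_height_inj x y : base x = base y -> height x = height y -> x = y.
Proof. by move=> b h; rewrite -(snoc_base x) b h snoc_base. Qed.

Lemma dot_base_height x y :
  dot x y = dot (base x) (base y) + height x * height y.
Proof.
rewrite /dot big_ord_recr /=; congr (_ + _); apply: eq_bigr => i _.
rewrite !mxE; suff -> : widen_ord (leqnSn m) i = lift ord_max i by [].
by apply: val_inj; rewrite /= /bump leqNgt ltn_ord.
Qed.

Lemma heightB x y : height (x - y) = height x - height y.
Proof. by rewrite /height !mxE. Qed.

End last_coordinate.

(** * Hyperplanes through given points, and the moment curve *)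

(** A matrix with [n.+1] rows and [n] columns has a nonzero left kernel. *)
Lemma exists_common_orthogonal (R : realType) n (L : 'I_n -> 'rV[R]_n.+1) :
  exists2 c, c != 0 & forall j, dot c (L j) = 0.
Proof.
pose A := \matrix_(i < n.+1, j < n) L j ord0 i.
have : kermx A != 0.
  by rewrite -mxrank_eq0 mxrank_ker -lt0n subn_gt0 ltnS rank_leq_col.
case/rowV0Pn => c /sub_kermxP cA c0; exists c => // j.
have /rowP/(_ j) := cA; rewrite !mxE => <-.
by apply: eq_bigr => i _; rewrite mxE.
Qed.

Lemma size_le_of_roots (R : realType) (p : {poly R}) (t : nat -> R) n
    (I : seq nat) : p != 0 -> (size p <= n.+1)%N -> injective t -> uniq I ->
  (forall j, j \in I -> p.[t j] = 0) -> (size I <= n)%N.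
Proof.
move=> p0 pn tinj uI rI; rewrite -(size_map t) -ltnS (leq_trans _ pn)//.
rewrite max_poly_roots ?map_inj_uniq//.
by apply/allP => _ /mapP[j jI ->]; apply/rootP/rI.
Qed.

(** Exponents start at 1, which leaves the constant coefficient free for the affine term of a
    hyperplane equation. *)
Definition moments (R : realType) n (t : R) : 'rV[R]_n := \row_i t ^+ i.+1.

Lemma horner_moments (R : realType) n (b : 'rV[R]_n) t :
  ('X * rVpoly b).[t] = dot b (moments n t).
Proof.
rewrite hornerM hornerX horner_poly mulr_sumr; apply: eq_bigr => i _.
by rewrite valK mxE exprS; ring.
Qed.

Lemma mulX_rVpoly_eq0 (R : realType) n (b : 'rV[R]_n) (c : R) :
  c%:P + 'X * rVpoly b = 0 -> b = 0.
Proof.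
move=> p0; apply/rowP => i; rewrite mxE -coef_rVpoly_ord.
have := congr1 (fun p : {poly R} => p`_i.+1) p0.
by rewrite coefD coefC coefXM coef0 add0r.
Qed.

Lemma size_mulX_rVpoly (R : realType) n (b : 'rV[R]_n) (c : R) :
  (size (c%:P + 'X * rVpoly b)%R <= n.+1)%N.
Proof.
rewrite (leq_trans (size_polyD _ _))// geq_max.
rewrite (leq_trans (size_polyC_leq1 _))//= mulrC.
rewrite (leq_trans (size_polyMleq _ _))// size_polyX addn2/= ltnS.
exact: size_poly.
Qed.

(** * Euclidean space *)

Lemma kmetric_dim_euclidean (R : realType) (n k : nat) : (0 < n)%N -> (0 < k)%N ->
  kmetric_dim [set: 'rV[R]_n] (@euclidean_dist R n) k = (n + k)%:R%:E.
Proof.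
move=> n0 k0; apply/eqP; rewrite eq_le; apply/andP; split; last first.
  apply: (@kmetric_dim_ge _ _ _ _ _ _ 0) => // p _.
  (* The appended 1 turns orthogonality to [c] into an affine equation with normal [base c]. *)
  have [c c0 cL] := exists_common_orthogonal (fun j : 'I_n => snoc (p j) 1).
  have cp j : (j < n)%N -> dot (base c) (p j) = - height c.
    move=> jn; have := cL (Ordinal jn).
    by rewrite dot_base_height base_snoc height_snoc mulr1 => /eqP; rewrite addr_eq0 => /eqP.
  (* Mirror images in the hyperplane, which contains [p 0]. They differ: if [base c] were 0, the
     equation at [p 0] would give [height c = 0] as well. *)
  exists (p 0%N + base c), (p 0%N - base c); split=> //.
    move=> /addrI e; case/eqP: c0; have b0 : base c = 0.
      have : 2%:R *: base c = 0 by rewrite scaler_nat mulr2n {2}e subrr.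
      by move/eqP; rewrite scaler_eq0 pnatr_eq0/= => /eqP.
    apply: base_height_inj; first by rewrite b0; apply/rowP => i; rewrite !mxE.
    rewrite /height mxE -[LHS]opprK -[X in - X = _]/(- height c).
    by rewrite -(cp 0%N n0) b0 dot0l oppr0.
  move=> j jn; apply/euclidean_dist_eq.
  rewrite !dotE (dotC (p 0%N) (base c)) !cp//; ring.
pose t (j : nat) : R := j%:R.
have tI : injective t by move=> i j /eqP; rewrite eqr_nat => /eqP.
apply: (@kmetric_dim_le _ _ _ _ _ _ (fun j => moments n (t j))) => //.
  move=> i j /rowP/(_ (Ordinal n0)); rewrite !mxE !expr1; exact: tI.
move=> u v _ _ uv I uI duv.
pose b := - 2 *: (u - v).
(* The bisector equation evaluated along the moment curve. *)
pose p : {poly R} := (dot u u - dot v v)%:P + 'X * rVpoly b.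
apply: (@size_le_of_roots _ p t) => // [||j jI]; last first.
- move/euclidean_dist_eq: (duv j jI) => <-.
  by rewrite hornerD hornerC horner_moments dotZl mulNr.
- exact: size_mulX_rVpoly.
apply/eqP => /mulX_rVpoly_eq0/eqP; rewrite scaler_eq0 oppr_eq0 pnatr_eq0/=.
by rewrite subr_eq0 => /eqP.
Qed.

(** * The sphere *)

(** By Cauchy-Schwarz the inner products lie in [-1, 1], where [acos] is injective. *)
Lemma spherical_dist_eq (R : realType) n (x y z : 'rV[R]_n.+1) :
  sphere x -> sphere y -> sphere z ->
  spherical_dist x z = spherical_dist y z <-> dot (x - y) z = 0.
Proof.
have unit w : @sphere R n w -> dot w w = 1 by move=> /= w1; rewrite -enorm_sqr w1 expr1n.
have dot_itv v w : @sphere R n v -> sphere w -> dot v w \in `[-1, 1].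
  move=> /unit v1 /unit w1; have := cauchy_schwarz_dot v w.
  by rewrite v1 w1 mul1r in_itv/= => ?; apply/andP; split; nra.
move=> sx sy sz; rewrite dotDl dotNl; split=> [|/subr0_eq e]; last first.
  by rewrite /spherical_dist e.
by move/(congr1 cos); rewrite !acosK ?dot_itv// => ->; rewrite subrr.
Qed.

Lemma sphere_normalize (R : realType) n (x : 'rV[R]_n.+1) : x != 0 ->
  sphere ((enorm x)^-1 *: x).
Proof.
move=> x0; rewrite /sphere/= {1}/enorm !dotE -enorm_sqr.
have ex : 0 < enorm x by rewrite sqrtr_gt0 lt0r dot_eq0 x0 dot_ge0.
by rewrite expr2 !mulrA -(mulrA _^-1) mulVf ?gt_eqF// mulr1 mulVf ?gt_eqF// sqrtr1.
Qed.

Lemma kmetric_dim_sphere (R : realType) (n k : nat) : (0 < n)%N -> (0 < k)%N ->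
  kmetric_dim (@sphere R n) (@spherical_dist R n) k = (n + k)%:R%:E.
Proof.
move=> n0 k0; apply/eqP; rewrite eq_le; apply/andP; split; last first.
  have one0 : (const_mx 1 : 'rV[R]_n.+1) != 0.
    by apply/eqP => /rowP/(_ ord0)/eqP; rewrite !mxE oner_eq0.
  apply: (kmetric_dim_ge (sphere_normalize one0)) => // p ps.
  have [c c0 cL] := exists_common_orthogonal (fun j : 'I_n => p j).
  have sc := sphere_normalize c0.
  have snc : sphere (- ((enorm c)^-1 *: c)).
    by move: sc; rewrite /sphere/= /enorm dotNl dotNr opprK.
  (* The two unit normals of a hyperplane through the origin are at equal distance from each of its
     points. *)
  exists ((enorm c)^-1 *: c), (- ((enorm c)^-1 *: c)); split=> //.
    move=> /eqP; rewrite -subr_eq0 opprK -mulr2n -scaler_nat scaler_eq0 pnatr_eq0/=.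
    move=> /eqP e; move: sc; rewrite e /sphere/= /enorm.
    by rewrite dot0l sqrtr0 => /eqP; rewrite eq_sym oner_eq0.
  move=> j jn; apply/spherical_dist_eq => //.
  by rewrite !dotE (cL (Ordinal jn)); ring.
pose t (j : nat) : R := j%:R.
have tI : injective t by move=> i j /eqP; rewrite eqr_nat => /eqP.
(* Here exponents start at 0: the first coordinate 1 keeps [q j] nonzero and, after normalization,
   reveals the scaling factor; the second coordinate then gives [t j]. *)
pose q (j : nat) : 'rV[R]_n.+1 := \row_i t j ^+ i.
have q0 j : q j != 0.
  by apply/eqP => /rowP/(_ ord0)/eqP; rewrite !mxE expr0 oner_eq0.
have eq0 j : (enorm (q j))^-1 != 0.
  by rewrite invr_eq0 gt_eqF// sqrtr_gt0 lt0r dot_eq0 q0 dot_ge0.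
have sq j := sphere_normalize (q0 j).
apply: (@kmetric_dim_le _ _ _ _ _ _ (fun j => (enorm (q j))^-1 *: q j)) => //.
  move=> i j e; apply: tI.
  have := congr1 (fun x : 'rV[R]_n.+1 => x ord0 ord0) e; rewrite !mxE !mulr1 => e0.
  have := congr1 (fun x : 'rV[R]_n.+1 => x ord0 (Ordinal (n0 : (1 < n.+1)%N))) e.
  by rewrite !mxE !expr1 e0 => /(mulfI (eq0 j)).
move=> u v su sv uv I uI duv.
apply: (@size_le_of_roots _ (rVpoly (u - v)) t) => // [||j jI].
- apply/eqP => /(congr1 (@poly_rV _ n.+1)); rewrite rVpolyK linear0 => /eqP.
  by rewrite subr_eq0 => /eqP.
- exact: size_poly.
have /spherical_dist_eq := duv j jI; rewrite dotZr => /(_ su sv (sq j))/eqP.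
rewrite mulf_eq0 (negbTE (eq0 j))/= => /eqP <-.
by rewrite horner_poly; apply: eq_bigr => i _; rewrite valK [q j _ _]mxE.
Qed.

(** * Calculus along curves *)

Section calculus.
Variable R : realType.
Notation mu := (@lebesgue_measure R).

Lemma is_derive_continuous (f : R -> R) (t df : R) :
  is_derive t 1 f df -> {for t, continuous f}.
Proof. by move=> [/derivable1_diffP/differentiable_continuous]. Qed.

(** The primitive [G] of [s] minus [f] has derivative [s - df >= 0] inside the interval, hence is
    nondecreasing. *)
Lemma increment_le_Rintegral (f df s : R -> R) :
  (forall t : R, t \in `[0, 1] -> {for t, continuous s}) ->
  (forall t : R, t \in `[0, 1] -> is_derive t 1 f (df t)) ->
  (forall t : R, t \in `[0, 1] -> df t <= s t) ->
  f 1 - f 0 <= Rintegral mu `[0, 1] s.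
Proof.
move=> cs f' le_df_s.
have cs01 : {within `[0, 1], continuous s} by exact: continuous_subspace_itv.
have is01 := continuous_compact_integrable (@segment_compact _ 0 1) cs01.
pose G x := parameterized_integral mu 0 x s.
have cG : {within `[0, 1], continuous G} by exact: parameterized_integral_continuous.
have sub01 (t : R) : t \in `]0, 1[ -> t \in `[0, 1].
  by rewrite !in_itv/= => /andP[/ltW-> /ltW->].
have G' (t : R) : t \in `]0, 1[ -> is_derive t 1 G (s t).
  move=> t01; have [] := @continuous_FTC1_closed _ s 0 t 1.
  - by move: t01; rewrite in_itv/= => /andP[].
  - exact: is01.
  - by move: t01; rewrite in_itv/= => /andP[].
  - exact/cs/sub01.
  by move=> dG <-; rewrite derive1E; exact: derivableP.
have D' (t : R) : t \in `]0, 1[ -> is_derive t 1 (G - f) (s t - df t).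
  by move=> t01; apply: is_deriveB; [exact: G'|exact/f'/sub01].
have cf : {within `[0, 1], continuous f}.
  by apply: continuous_subspace_itv => t t01; exact: (is_derive_continuous (f' t t01)).
have cD : {within `[0, 1], continuous (G - f)}.
  by move=> x; apply: continuousB; [exact: cG|exact: cf].
have := @ger0_derive1_le_cc _ (G - f) 0 1 _ _ cD 0 1.
rewrite !bound_itvE => /(_ _ _ ler01 ler01 ler01).
have -> : (G - f) 0 = - f 0.
  by rewrite !fctE /G /parameterized_integral set_itv1 Rintegral_set1 sub0r.
move=> h; suff : - f 0 <= (G - f) 1.
  by rewrite !fctE => h1; rewrite -[Rintegral _ _ _]/(G 1); lra.
apply: h => t t01; first by have [] := D' t t01.
rewrite derive1E (@derive_val _ _ _ _ _ _ _ (D' t t01)) subr_ge0.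
exact/le_df_s/sub01.
Qed.

Lemma is_derive_div (f g : R -> R) (t df dg : R) : is_derive t 1 f df ->
  is_derive t 1 g dg -> g t != 0 ->
  is_derive t 1 (fun s => f s / g s) ((df * g t - f t * dg) / g t ^+ 2).
Proof.
move=> f' g' gt0; have gV := is_deriveV gt0 g'.
apply: (is_derive_eq (is_deriveM f' gV)).
by rewrite /GRing.scale/=; field.
Qed.

Lemma is_derive_dot n (g h : R -> 'rV[R]_n) (t : R) (v w : 'rV[R]_n) :
  (forall i, is_derive t 1 (fun s => g s ord0 i) (v ord0 i)) ->
  (forall i, is_derive t 1 (fun s => h s ord0 i) (w ord0 i)) ->
  is_derive t 1 (fun s => dot (g s) (h s)) (dot v (h t) + dot (g t) w).
Proof.
move=> g' h'.
have -> : (fun s => dot (g s) (h s)) =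
    \sum_(i < n) ((fun s => g s ord0 i) * (fun s => h s ord0 i)).
  by apply/funext => s; rewrite fct_sumE.
apply: (is_derive_eq (is_derive_sum (fun i => is_deriveM (g' i) (h' i)))).
rewrite /dot -big_split; apply: eq_bigr => i _.
by rewrite /GRing.scale/=; ring.
Qed.

Lemma continuous_dot n (g h : R -> 'rV[R]_n) (t : R) :
  (forall i, {for t, continuous (fun s => g s ord0 i)}) ->
  (forall i, {for t, continuous (fun s => h s ord0 i)}) ->
  {for t, continuous (fun s => dot (g s) (h s))}.
Proof.
move=> cg ch; rewrite /dot; apply: cvg_big => [|i _]; first exact: add_continuous.
by apply: cvgM; [exact: cg|exact: ch].
Qed.

(** Calibration: it will be applied to a Busemann function along [g]. *)
Lemma increment_le_hyperbolic_length n (g : R -> 'rV[R]_n.+1) x y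
    (f df : R -> R) :
  half_space_curve x y g ->
  (forall t : R, t \in `[0, 1] -> is_derive t 1 f (df t)) ->
  (forall t : R, t \in `[0, 1] ->
     df t <= enorm (velocity g t) / height (g t)) ->
  f 1 - f 0 <= hyperbolic_length g.
Proof.
move=> [dg cv Xg _ _] f' le_df; apply: (increment_le_Rintegral _ f' le_df) => t t01.
have gt0 : 0 < height (g t) by apply: Xg; rewrite in_itv/= in t01.
apply: cvgM; last first.
  apply: cvgV; first by rewrite gt_eqF.
  exact: (is_derive_continuous (derivableP (dg ord_max t))).
have cdot := @continuous_dot _ (velocity g) (velocity g) t (cv^~ t) (cv^~ t).
exact: (cvg_comp _ (@Num.sqrt R) cdot (@sqrt_continuous R _)).
Qed.

Lemma is_derive_velocity n (g : R -> 'rV[R]_n) (t : R) i :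
  derivable (fun s => g s ord0 i) t 1 ->
  is_derive t 1 (fun s => g s ord0 i) (velocity g t ord0 i).
Proof. by move=> dg; rewrite mxE derive1E; exact: derivableP. Qed.

End calculus.

(** * Ends of the geodesic and Busemann functions *)

Section hyperbolic_distance.
Variables (R : realType) (m : nat).
Implicit Types (x y w : 'rV[R]_m.+1) (F D : R).

Definition vert : 'rV[R]_m.+1 := snoc 0 1.

Lemma dot_vert x : dot x vert = height x.
Proof.
by rewrite dot_base_height base_snoc height_snoc mulr1 dot0r add0r.
Qed.

Lemma dot_vertl x : dot vert x = height x.
Proof. by rewrite dotC dot_vert. Qed.

Lemma height_vert : height vert = 1.
Proof. exact: height_snoc. Qed.

Lemma heightD x y : height (x + y) = height x + height y.
Proof. by rewrite /height mxE. Qed.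

Lemma heightZ (a : R) x : height (a *: x) = a * height x.
Proof. by rewrite /height mxE. Qed.

Definition cosh_dist x y : R :=
  1 + dot (x - y) (x - y) / (2 * height x * height y).

Lemma cosh_distC x y : cosh_dist x y = cosh_dist y x.
Proof.
by rewrite /cosh_dist -(opprB y) dotNl dotNr opprK -!mulrA (mulrC (height x)).
Qed.

(* In the light-cone coordinates (1 / x_n, x' / x_n, |x|^2 / x_n) of the
   hyperboloid, x' being the projection of x to the boundary hyperplane, the
   triple (poleA, poleB, poleC) is the vector Y - F X; poleB keeps the ambient
   dimension, its last coordinate being 0. *)
Definition poleA F x y : R := (height y)^-1 - F / height x.
Definition poleB F x y : 'rV[R]_m.+1 :=
  (height y)^-1 *: y - (F / height x) *: x - (1 - F) *: vert.
Definition poleC F x y : R := dot y y / height y - F * dot x x / height x.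

(** Divided by [height w], this is [2 * cosh_dist y w - 2 * F * cosh_dist x w], up to sign and scale
    the Lorentz product of Y - F X with the hyperboloid point of [w]. *)
Definition pole_form F x y w : R :=
  poleA F x y * dot w w - 2 * dot (poleB F x y) w + poleC F x y.

Lemma height_poleB F x y : 0 < height x -> 0 < height y ->
  height (poleB F x y) = 0.
Proof.
move=> hx hy; rewrite -dot_vert !dotE !dot_vert height_vert.
by field; rewrite !gt_eqF.
Qed.

Section poles.
Variables (F : R) (x y : 'rV[R]_m.+1).
Hypotheses (hx : 0 < height x) (hy : 0 < height y) (F0 : 0 < F).
Hypothesis FC : F ^-1 + F = 2 * cosh_dist x y.

(** [FC] solved for [dot x y]; substituting it turns the identities below into rational ones. *)
Let dotxy : dot x y = (dot x x + dot y y + 2 * height x * height y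
  - (F ^-1 + F) * height x * height y) / 2.
Proof.
rewrite FC /cosh_dist !dotE (dotC y x); field.
by rewrite !gt_eqF.
Qed.

(** Y - F X is light-like, since 1 - F (F^-1 + F) + F^2 = 0. *)
Lemma dot_poleB : dot (poleB F x y) (poleB F x y) = poleA F x y * poleC F x y.
Proof.
rewrite !dotE !dot_vert !dot_vertl height_vert (dotC y x) dotxy /poleA /poleC.
by field; rewrite !gt_eqF.
Qed.

(** The Lorentz product of the two poles Y - F X and X - F Y, needed for the speed of the
    geodesic. *)
Lemma dot_poleB_swap : 2 * dot (poleB F x y) (poleB F y x) =
  poleA F y x * poleC F x y + poleA F x y * poleC F y x - (1 - F ^+ 2) ^+ 2 / F.
Proof.
rewrite !dotE !dot_vert !dot_vertl height_vert (dotC y x) dotxy /poleA /poleC.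
by field; rewrite !gt_eqF.
Qed.

(** With [pole_form_r]: after division by the heights, the values at [x] and [y] have ratio F^-1 =
    exp(D). *)
Lemma pole_form_l : pole_form F x y x = (F^-1 - F) * height x.
Proof.
rewrite /pole_form !dotE !dot_vertl (dotC y x) dotxy /poleA /poleC.
by field; rewrite !gt_eqF.
Qed.

Lemma pole_form_r : pole_form F x y y = (1 - F ^+ 2) * height y.
Proof.
rewrite /pole_form !dotE !dot_vertl dotxy /poleA /poleC.
by field; rewrite !gt_eqF.
Qed.

Lemma poleA_ge0 : F < 1 -> 0 <= poleA F x y.
Proof.
move=> F1.
(* The vertical part of |x - y|^2 is at most the whole. This factors as (x_n - F y_n)(F x_n - y_n)
   <= 0, and a negative first factor would make the second one negative too. *)
have h : F * (height x - height y) ^+ 2 <= (F - 1) ^+ 2 * height x * height y.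
  have := dot_ge0 (base (x - y)).
  have -> : dot (base (x - y)) (base (x - y)) =
      dot (x - y) (x - y) - (height x - height y) ^+ 2.
    by rewrite [dot (x - y) _]dot_base_height heightB; ring.
  rewrite !dotE (dotC y x) dotxy => h.
  have Fh := mulr_ge0 (ltW F0) h.
  rewrite -subr_ge0; apply: le_trans Fh _; rewrite le_eqVlt; apply/orP; left.
  by apply/eqP; field; rewrite gt_eqF.
have -> : poleA F x y = (height x - F * height y) / (height x * height y).
  by rewrite /poleA; field; rewrite !gt_eqF.
rewrite divr_ge0 ?mulr_ge0 ?(ltW hx) ?(ltW hy)// leNgt; apply/negP => lt.
have lt1 : F * (height x - F * height y) < 0 by rewrite pmulr_rlt0.
have lt2 : 0 < (1 - F ^+ 2) * height y by rewrite mulr_gt0// subr_gt0 expr_lt1// ltW.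
have : 0 < (height x - F * height y) * (F * height x - height y).
  by rewrite nmulr_rgt0//; lra.
by lra.
Qed.

(** If [poleA] is 0, light-likeness forces [poleB] to be 0, and the form is a constant, positive at
    [x]. Otherwise complete the square; [poleB] being horizontal, the term in [height w]
    survives. *)
Lemma pole_form_gt0 w : F < 1 -> 0 < height w -> 0 < pole_form F x y w.
Proof.
move=> F1 hw; have [a0|a0] := eqVneq (poleA F x y) 0.
  have b0 : poleB F x y = 0 by apply/eqP; rewrite -dot_eq0 dot_poleB a0 mul0r.
  have : 0 < pole_form F x y x.
    by rewrite pole_form_l mulr_gt0// subr_gt0 (lt_trans F1)// invf_gt1.
  by rewrite /pole_form a0 b0 !dot0l !mul0r.
have a_gt0 : 0 < poleA F x y by rewrite lt0r a0 poleA_ge0.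
rewrite -(pmulr_rgt0 _ a_gt0).
have := height_poleB F hx hy; have := dot_poleB; rewrite /pole_form.
move: (poleB F x y) => b bb hb.
pose v := poleA F x y *: w - b - (poleA F x y * height w) *: vert.
have -> : poleA F x y * (poleA F x y * dot w w - 2 * dot b w + poleC F x y) =
    dot v v + (poleA F x y * height w) ^+ 2.
  by rewrite /v !dotE !dot_vert !dot_vertl height_vert (dotC w b) hb bb; ring.
by rewrite ltr_wpDl ?dot_ge0// exprn_gt0// mulr_gt0.
Qed.

(** At most one end of the geodesic is the point at infinity, where [poleA] vanishes. *)
Lemma poleA_gt0 : F < 1 -> 0 < poleA F x y \/ 0 < poleA F y x.
Proof.
move=> F1; have [|a0] := ltP 0 (poleA F x y); first by left.
right; rewrite /poleA subr_gt0; move: a0; rewrite /poleA subr_le0 => a0.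
apply: (@le_lt_trans _ _ (F * (F / height x))); first by rewrite ler_pM2l.
by rewrite mulrA gtr_pMl ?invr_gt0// -expr2 expr_lt1// ltW.
Qed.

(* The gradient of the Busemann function w |-> ln (pole_form w / height w) has
   hyperbolic norm 1: this is its derivative in the direction - z, with the
   denominators cleared. *)
Lemma pole_form_lipschitz w z : F < 1 -> 0 < height w ->
  pole_form F x y w * height z
    - 2 * (poleA F x y * dot w z - dot (poleB F x y) z) * height w <=
  pole_form F x y w * enorm z.
Proof.
move=> F1 hw; have p0 := pole_form_gt0 F1 hw.
set q := pole_form F x y w / height w.
have q0 : 0 < q by rewrite divr_gt0.
have qE : pole_form F x y w = q * height w by rewrite /q divfK// gt_eqF.
have := height_poleB F hx hy; have := dot_poleB.
move: qE; rewrite /pole_form.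
move: (poleB F x y) => b qE bb hb.
(* [v / height w] is the Euclidean gradient of [pole_form / height] at [w]; light-likeness gives |v|
   = q, and Cauchy-Schwarz concludes. *)
pose v := (2 * poleA F x y) *: w - 2 *: b - q *: vert.
have vv : dot v v = q ^+ 2.
  transitivity (q ^+ 2 + 4 * poleA F x y *
      (poleA F x y * dot w w - 2 * dot b w + poleC F x y - q * height w)).
    by rewrite /v !dotE !dot_vert !dot_vertl height_vert (dotC w b) hb bb; ring.
  by rewrite qE subrr mulr0 addr0.
have cs := cauchy_schwarz_dot v z; rewrite vv -enorm_sqr in cs.
have vz : - dot v z <= q * enorm z.
  have : 0 <= q * enorm z by rewrite mulr_ge0 ?sqrtr_ge0// ltW.
  by move: cs; rewrite -exprMn; set A := dot v z; set B := q * _; nra.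
rewrite qE.
have -> : q * height w * height z
    - 2 * (poleA F x y * dot w z - dot b z) * height w = - dot v z * height w.
  by rewrite /v !dotE dot_vertl; ring.
by rewrite mulrAC ler_pM2r.
Qed.

End poles.
End hyperbolic_distance.

(** * Lower bound on the length of curves *)

Section hyperbolic_distance_formula.
Variables (R : realType) (m : nat).
Implicit Types (x y : 'rV[R]_m.+1) (F D : R).

Lemma hyperbolic_length_ge x y D (g : R -> 'rV[R]_m.+1) :
  half_space x -> half_space y -> 0 < D ->
  expR D + expR (- D) = 2 * cosh_dist x y ->
  half_space_curve x y g -> D <= hyperbolic_length g.
Proof.
move=> hx hy D0 CD gxy; have [dg _ Xg g0 g1] := gxy.
pose F := expR (- D).
have F0 : 0 < F by exact: expR_gt0.
have F1 : F < 1 by rewrite -expR0 ltr_expR oppr_lt0.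
have FV : F^-1 = expR D by rewrite /F expRN invrK.
have FC : F^-1 + F = 2 * cosh_dist x y by rewrite FV.
pose N t := pole_form F x y (g t).
pose N' t := 2 * (poleA F x y * dot (g t) (velocity g t)
                  - dot (poleB F x y) (velocity g t)).
pose z t := height (velocity g t).
(* Minus the Busemann function along [g]; it increases by [D] from 0 to 1. *)
pose f t := - ln (N t / height (g t)).
have gt0 (t : R) : t \in `[0, 1] -> 0 < height (g t) by rewrite in_itv/= => /Xg.
have Nt0 (t : R) : t \in `[0, 1] -> 0 < N t.
  by move=> /gt0 ?; exact: pole_form_gt0.
have f' (t : R) : t \in `[0, 1] -> is_derive t 1 f
    (- ((N t / height (g t))^-1 *
        ((N' t * height (g t) - N t * z t) / height (g t) ^+ 2))).
  move=> t01.
  have g' i := is_derive_velocity (dg i t).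
  have gg := is_derive_dot g' g'.
  have cst0 i : is_derive t 1 (fun s : R => poleB F x y ord0 i)
      ((0 : 'rV[R]_m.+1) ord0 i) 
    by apply: (is_derive_eq (is_derive_cst _ _ _)); rewrite mxE.
  have bg := is_derive_dot cst0 g'.
  have dN : is_derive t 1 N (N' t).
    have -> : N = poleA F x y \*: (fun s => dot (g s) (g s)) -
        2 \*: (fun s => dot (poleB F x y) (g s)) + cst (poleC F x y).
      by apply/funext.
    apply: (is_derive_eq (is_deriveD (is_deriveB (is_deriveZ _ gg)
      (is_deriveZ _ bg)) (is_derive_cst _ _ _))).
    by rewrite /N' /GRing.scale/= dot0l (dotC (velocity g t)); ring.
  pose h s := N s / height (g s).
  have ht0 : 0 < h t by rewrite divr_gt0 ?Nt0 ?gt0.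
  have dh : is_derive t 1 h
      ((N' t * height (g t) - N t * z t) / height (g t) ^+ 2).
    by apply: is_derive_div dN (g' ord_max) _; rewrite gt_eqF// gt0.
  exact: (is_deriveN (@is_derive1_comp R (@ln R) h t _ _ (is_derive1_ln ht0) dh)).
have := increment_le_hyperbolic_length gxy f'.
have -> : f 1 - f 0 = D.
  rewrite /f /N g0 g1 pole_form_l// pole_form_r// !mulfK ?gt_eqF//.
  have -> : F^-1 - F = (1 - F ^+ 2) / F by field; rewrite gt_eqF.
  rewrite FV lnM ?posrE ?expR_gt0// ?subr_gt0 ?expr_lt1// ?ltW// expRK; ring.
apply=> t t01; have Nt := Nt0 t t01; have ht := gt0 t t01.
have -> : - ((N t / height (g t))^-1 *
    ((N' t * height (g t) - N t * z t) / height (g t) ^+ 2)) =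
    (N t * z t - N' t * height (g t)) / (N t * height (g t)).
  by field; rewrite !gt_eqF.
rewrite ler_pdivrMr ?mulr_gt0//.
have -> : enorm (velocity g t) / height (g t) * (N t * height (g t)) =
  N t * enorm (velocity g t) by field; rewrite gt_eqF.
exact: pole_form_lipschitz.
Qed.

End hyperbolic_distance_formula.

(** * A curve attaining the bound *)

Section geodesic.
Variables (R : realType) (m : nat) (x y : 'rV[R]_m.+1) (D : R).
Hypotheses (hx : half_space x) (hy : half_space y) (D0 : 0 < D).
Hypothesis CD : expR D + expR (- D) = 2 * cosh_dist x y.

Let F := expR (- D).
Let k := F^-1 - F.
Let p (t : R) := expR (D * t).
Let q (t : R) := expR (D * (1 - t)).
Let a := poleA F x y.
Let a' := poleA F y x.
Let b := poleB F x y.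
Let b' := poleB F y x.
Let A t := p t * a + q t * a'.

(** On the hyperboloid this is (p(t) (Y - F X) + q(t) (X - F Y)) / k, equal to X at 0 and to Y at 1.
    Light-cone coordinates (alpha, beta, gamma) stand for the point with base beta / alpha and
    height 1 / alpha; here alpha is [A t / k]. *)
Definition geodesic (t : R) : 'rV[R]_m.+1 :=
  (A t)^-1 *: (p t *: b + q t *: b' + k *: vert R m).

Let F0 : 0 < F. Proof. exact: expR_gt0. Qed.
Let F1 : F < 1. Proof. by rewrite -expR0 ltr_expR oppr_lt0. Qed.
Let FC : F^-1 + F = 2 * cosh_dist x y. Proof. by rewrite -CD /F expRN invrK. Qed.
Let FC' : F^-1 + F = 2 * cosh_dist y x. Proof. by rewrite cosh_distC. Qed.
Let k0 : 0 < k. Proof. by rewrite subr_gt0 (lt_trans F1)// invf_gt1. Qed.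
Let p0 t : 0 < p t. Proof. exact: expR_gt0. Qed.
Let q0 t : 0 < q t. Proof. exact: expR_gt0. Qed.
Let pq t : q t = (F * p t)^-1.
Proof. by rewrite /q /F /p -expRD -expRN; congr expR; ring. Qed.

Let A_gt0 t : 0 < A t.
Proof.
have a0 := poleA_ge0 hx hy F0 FC F1; have a'0 := poleA_ge0 hy hx F0 FC' F1.
have [h|h] := poleA_gt0 y hx F0 F1.
  by rewrite ltr_pwDl ?mulr_gt0// mulr_ge0// ltW.
by rewrite ltr_wpDl ?mulr_gt0// mulr_ge0// ltW.
Qed.

Let is_derive_p (t : R) : is_derive t 1 p (D * p t).
Proof.
have -> : p = expR \o (D \*: id) by [].
have h := @is_derive1_comp R expR (D \*: id) t _ _ (is_derive_expR _)
  (is_deriveZ D (is_derive_id t 1)).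
by apply: (is_derive_eq h); rewrite /GRing.scale/= mulr1 mulrC.
Qed.

Let is_derive_q (t : R) : is_derive t 1 q (- (D * q t)).
Proof.
rewrite pq; have -> : q = (fun=> F^-1) \* (fun s => (p s)^-1).
  by apply/funext => s; rewrite pq invfM.
have h := is_deriveM (is_derive_cst (F^-1) t 1)
  (is_deriveV (lt0r_neq0 (p0 t)) (is_derive_p t)).
apply: (is_derive_eq h); rewrite /GRing.scale/=.
by field; rewrite !gt_eqF.
Qed.

Let is_derive_lin (al be ga : R) (t : R) :
  is_derive t 1 (fun s => p s * al + q s * be + ga) (D * (p t * al - q t * be)).
Proof.
have -> : (fun s => p s * al + q s * be + ga) =
   al \*: p + be \*: q + cst ga.
  by apply/funext => s; rewrite [LHS]/= (mulrC _ al) (mulrC _ be).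
apply: (is_derive_eq (is_deriveD (is_deriveD (is_deriveZ al (is_derive_p t))
  (is_deriveZ be (is_derive_q t))) (is_derive_cst _ _ _))).
by rewrite /GRing.scale/=; ring.
Qed.

Let dA (t : R) : is_derive t 1 A (D * (p t * a - q t * a')).
Proof.
have -> : A = (fun s => p s * a + q s * a' + 0) by apply/funext => s; rewrite addr0.
exact: is_derive_lin.
Qed.

Let geodesicE (t : R) i : geodesic t ord0 i =
  (p t * b ord0 i + q t * b' ord0 i + k * vert R m ord0 i) / A t.
Proof. by rewrite mxE mulrC; congr (_ / _); rewrite !mxE. Qed.

Let is_derive_geodesic (t : R) i : is_derive t 1 (fun s => geodesic s ord0 i)
  ((D * (p t * b ord0 i - q t * b' ord0 i) * A t -
    (p t * b ord0 i + q t * b' ord0 i + k * vert R m ord0 i) *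
    (D * (p t * a - q t * a'))) / A t ^+ 2).
Proof.
have -> : (fun s => geodesic s ord0 i) = (fun s =>
    (p s * b ord0 i + q s * b' ord0 i + k * vert R m ord0 i) / A s).
  by apply/funext => s; exact: geodesicE.
by apply: is_derive_div => //; rewrite gt_eqF.
Qed.

Let velocity_geodesic t : velocity geodesic t = (A t ^+ 2)^-1 *:
  ((D * A t) *: (p t *: b - q t *: b') - (D * (p t * a - q t * a')) *:
     (p t *: b + q t *: b' + k *: vert R m)).
Proof.
apply/rowP => i; rewrite mxE derive1E (@derive_val _ _ _ _ _ _ _ (is_derive_geodesic t i)).
move: b b' (vert R m) => b1 b2 e.
by rewrite !mxE; ring.
Qed.

(** The Lorentz products of the poles eliminate all inner products and leave a rational identity in
    [p t]. As the height is [k / A t], the hyperbolic speed is [D]. *)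
Let enorm_velocity t : enorm (velocity geodesic t) = D * k / A t.
Proof.
have : dot (velocity geodesic t) (velocity geodesic t) = (D * k / A t) ^+ 2.
  rewrite velocity_geodesic.
  have := dot_poleB hx hy F0 FC; have := dot_poleB hy hx F0 FC'.
  have := dot_poleB_swap hx hy F0 FC.
  have := height_poleB F hx hy; have := height_poleB F hy hx.
  rewrite /A -/a -/a' -/b -/b'; have := A_gt0 t; rewrite /A.
  move: (pq t) (p0 t) => ->; move: (p t) => pt pt0.
  move: a a' b b' (poleC F x y) (poleC F y x) => a1 a2 b1 b2 c1 c2 A0 h2 h1 s e2 e1.
  have s' : dot b1 b2 = (a2 * c1 + a1 * c2 - (1 - F ^+ 2) ^+ 2 / F) / 2.
    by rewrite -s; field.
  rewrite !dotE !dot_vert !dot_vertl height_vert (dotC b2 b1) h1 h2 e1 e2 s' /k.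
  (* [A t] with its denominator cleared, the side condition left by [field]. *)
  have A1 : pt * a1 * (F * pt) + a2 != 0.
    rewrite gt_eqF//; have := mulr_gt0 (mulr_gt0 F0 pt0) A0.
    suff -> : F * pt * (pt * a1 + (F * pt)^-1 * a2) = pt * a1 * (F * pt) + a2 by [].
    by field; rewrite !gt_eqF.
  by field; rewrite A1 !gt_eqF.
by rewrite /enorm => ->; rewrite sqrtr_sqr ger0_norm// divr_ge0 ?mulr_ge0 ?ltW.
Qed.

Let height_geodesic t : height (geodesic t) = k / A t.
Proof.
rewrite /geodesic heightZ !heightD !heightZ /b /b' !height_poleB// height_vert.
by rewrite !mulr0 !add0r mulr1 mulrC.
Qed.

Let kF0 : 1 + - F * F != 0.
Proof. by rewrite mulNr gt_eqF// subr_gt0 -expr2 expr_lt1// ltW. Qed.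

Let geodesic0 : geodesic 0 = x.
Proof.
have A0 : A 0 = k / height x.
  rewrite /A /p /q mulr0 expR0 subr0 mulr1 -[D]opprK expRN -/F /a /a' /poleA /k.
  by field; rewrite !gt_eqF.
rewrite /geodesic A0 /p /q mulr0 expR0 subr0 mulr1 -[D]opprK expRN -/F.
apply/rowP => i; rewrite /b /b' /poleB; move: (vert R m) => e.
by rewrite !mxE /k; field; rewrite kF0 !gt_eqF.
Qed.

Let geodesic1 : geodesic 1 = y.
Proof.
have A1 : A 1 = k / height y.
  rewrite /A /p /q subrr mulr0 expR0 mulr1 -[D]opprK expRN -/F /a /a' /poleA /k.
  by field; rewrite !gt_eqF.
rewrite /geodesic A1 /p /q subrr mulr0 expR0 mulr1 -[D]opprK expRN -/F.
apply/rowP => i; rewrite /b /b' /poleB; move: (vert R m) => e.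
by rewrite !mxE /k; field; rewrite kF0 !gt_eqF.
Qed.

Lemma geodesic_curve : half_space_curve x y geodesic.
Proof.
split.
- by move=> i t; exact: (@ex_derive _ _ _ _ _ _ _ (is_derive_geodesic t i)).
- move=> i t.
  have cp := is_derive_continuous (is_derive_p t).
  have cq := is_derive_continuous (is_derive_q t).
  have cA := is_derive_continuous (dA t).
  have -> : (fun s => velocity geodesic s ord0 i) = (fun s =>
      (D * (p s * b ord0 i - q s * b' ord0 i) * A s -
      (p s * b ord0 i + q s * b' ord0 i + k * vert R m ord0 i) *
      (D * (p s * a - q s * a'))) * (A s * A s)^-1).
    apply/funext => s; rewrite mxE derive1E.
    by rewrite (@derive_val _ _ _ _ _ _ _ (is_derive_geodesic s i)).
  apply: cvgM; last first.
    by apply: cvgV; [rewrite gt_eqF// mulr_gt0|apply: cvgM].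
  by repeat (apply: cvgB || apply: cvgD || apply: cvgM || exact: cvg_cst ||
             exact: cp || exact: cq || exact: cA).
- move=> t _; suff : 0 < height (geodesic t) by [].
  by rewrite height_geodesic divr_gt0.
- exact: geodesic0.
- exact: geodesic1.
Qed.

Lemma hyperbolic_length_geodesic : hyperbolic_length geodesic = D.
Proof.
rewrite /hyperbolic_length (@eq_Rintegral _ _ _ _ _ (cst D)); last first.
  move=> t _; rewrite enorm_velocity height_geodesic [RHS]/=.
  by field; rewrite !gt_eqF.
by rewrite Rintegral_cst//= lebesgue_measure_itv/= lte01 oppr0 adde0/= mulr1.
Qed.

End geodesic.

(** * The distance formula and hyperbolic bisectors *)

Section hyperbolic_metric.
Variables (R : realType) (m : nat).
Implicit Types (u v w x y : 'rV[R]_m.+1).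

Lemma cosh_dist_ge1 x y : half_space x -> half_space y -> 1 <= cosh_dist x y.
Proof.
by move=> hx hy; rewrite lerDl divr_ge0 ?dot_ge0// !mulr_ge0// ltW.
Qed.

Lemma exists_arcosh (c : R) : 1 <= c ->
  exists2 D, 0 <= D & expR D + expR (- D) = 2 * c.
Proof.
move=> c1; have c2 : 0 <= c ^+ 2 - 1 by rewrite subr_ge0 exprn_ege1.
have s0 := sqrtr_ge0 (c ^+ 2 - 1); have := sqr_sqrtr c2.
move: (Num.sqrt _) s0 => s s0 sE; have cs : 0 < c + s by lra.
exists (ln (c + s)); first by rewrite ln_ge0//; lra.
rewrite expRN lnK ?posrE//; have -> : (c + s)^-1 = c - s.
  by apply: (mulfI (lt0r_neq0 cs)); rewrite divff ?gt_eqF//; nra.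
ring.
Qed.

Lemma hyperbolic_length_ge0 (g : R -> 'rV[R]_m.+1) x y :
  half_space_curve x y g -> 0 <= hyperbolic_length g.
Proof.
move=> [_ _ Xg _ _]; apply: Rintegral_ge0 => t /=; rewrite in_itv/= => t01.
by rewrite divr_ge0 ?sqrtr_ge0// ltW//; exact: Xg.
Qed.

Lemma hyperbolic_distxx x : half_space x -> hyperbolic_dist x x = 0.
Proof.
move=> hx; have v0 t : velocity (fun=> x) t = 0.
  by apply/rowP => i; rewrite !mxE derive1_cst.
have cx : half_space_curve x x (fun=> x).
  split=> // i t.
  by under eq_fun do rewrite v0; exact: cvg_cst.
have l0 : hyperbolic_length (fun=> x) = 0.
  rewrite /hyperbolic_length (@eq_Rintegral _ _ _ _ _ (cst 0)); last first.
    by move=> t _; rewrite v0 /enorm dot0l sqrtr0 mul0r.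
  by rewrite Rintegral_cst ?mul0r.
apply/eqP; rewrite eq_le; apply/andP; split.
  rewrite -l0; apply: ge_inf; last by exists (fun=> x).
  by exists 0 => _ [g gx <-]; exact: hyperbolic_length_ge0 gx.
apply: lb_le_inf; first by exists 0, (fun=> x).
by move=> _ [g gx <-]; exact: hyperbolic_length_ge0 gx.
Qed.

Lemma cosh_hyperbolic_dist x y : half_space x -> half_space y ->
  0 <= hyperbolic_dist x y /\
  expR (hyperbolic_dist x y) + expR (- hyperbolic_dist x y) = 2 * cosh_dist x y.
Proof.
move=> hx hy; have [D D0 CD] := exists_arcosh (cosh_dist_ge1 hx hy).
suff -> : hyperbolic_dist x y = D by [].
(* For [D = 0] the factor [k] of the geodesic vanishes; then [x = y] and the constant curve is
   used. *)
have [D_eq0|D_neq0] := eqVneq D 0.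
  have : cosh_dist x y == 1 by move: CD; rewrite D_eq0 oppr0 expR0 => ?; apply/eqP; lra.
  rewrite -subr_eq0 [_ - 1]addrC addKr mulf_eq0 dot_eq0 subr_eq0 invr_eq0 !mulf_eq0.
  rewrite pnatr_eq0/= !gt_eqF// !orbF => /eqP <-; rewrite D_eq0; exact: hyperbolic_distxx.
have Dgt0 : 0 < D by rewrite lt0r D_neq0.
have gxy := geodesic_curve hx hy Dgt0 CD.
apply/eqP; rewrite eq_le; apply/andP; split.
  rewrite -[leRHS](hyperbolic_length_geodesic hx hy Dgt0 CD).
  apply: ge_inf; last by exists (geodesic x y D).
  by exists 0 => _ [g gx <-]; exact: hyperbolic_length_ge0 gx.
apply: lb_le_inf; first by exists (hyperbolic_length (geodesic x y D)), (geodesic x y D).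
by move=> _ [g gx <-]; exact: hyperbolic_length_ge gx.
Qed.

Lemma hyperbolic_dist_cosh_eq u v w :
  half_space u -> half_space v -> half_space w ->
  hyperbolic_dist u w = hyperbolic_dist v w <-> cosh_dist u w = cosh_dist v w.
Proof.
move=> hu hv hw; have [d0 dE] := cosh_hyperbolic_dist hu hw.
have [d'0 d'E] := cosh_hyperbolic_dist hv hw.
split=> [e|e].
  by apply: (@mulfI _ (2%:R : R)); rewrite ?pnatr_eq0// -dE -d'E e.
move: dE d'E; rewrite e => <-; move: d0 d'0.
move: (hyperbolic_dist u w) (hyperbolic_dist v w) => d d' d0 d'0.
rewrite !expRN => E; apply: expR_inj.
have := expR_gt0 d; have := expR_gt0 d'.
have : 1 <= expR d by rewrite -expR0 ler_expR.
have : 1 <= expR d' by rewrite -expR0 ler_expR.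
move: (expR d) (expR d') E => a b E b1 a1 b0 a0.
(* Injectivity of cosh on nonnegative reals: if [a * b = 1] with [a, b >= 1], both are 1. *)
have : (a - b) * (a * b - 1) = 0.
  have -> : (a - b) * (a * b - 1) = (a + a^-1 - (b + b^-1)) * (a * b).
    by field; rewrite !gt_eqF.
  by rewrite E subrr mul0r.
by move=> /eqP; rewrite mulf_eq0 => /orP[] /eqP; nra.
Qed.

(* Clearing denominators turns the equation of a bisector into a linear one in
   the coordinates (w_1, ..., w_(n-1), |w|^2, 1) of w: the terms in w_n cancel. *)
Lemma hyperbolic_dist_eq u v w :
  half_space u -> half_space v -> half_space w ->
  hyperbolic_dist u w = hyperbolic_dist v w <->
  ((height u)^-1 - (height v)^-1) * dot w w
   - 2 * dot ((height u)^-1 *: base u - (height v)^-1 *: base v) (base w)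
   + (dot u u / height u - dot v v / height v) = 0.
Proof.
move=> hu hv hw; have := hyperbolic_dist_cosh_eq hu hv hw.
set l := (X in _ -> (_ <-> X = 0)).
suff -> : l = (cosh_dist u w - cosh_dist v w) * (2 * height w).
  move=> ->; split=> [->|/eqP]; first by rewrite subrr mul0r.
  by rewrite mulf_eq0 !mulf_eq0 pnatr_eq0/= (gt_eqF hw) !orbF subr_eq0 => /eqP.
rewrite /l /cosh_dist !dotE (dotC w u) (dotC w v).
rewrite (dot_base_height u w) (dot_base_height v w).
by field; rewrite !gt_eqF.
Qed.

End hyperbolic_metric.

(** * Hyperbolic space *)

Section hyperbolic_dimension.
Variables (R : realType) (m : nat).
Implicit Types (u v w : 'rV[R]_m.+1) (b : 'rV[R]_m) (a c : R).

(** The half-space point whose first light-cone coordinates are [a] and [b]. *)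
Let point b (a : R) : 'rV[R]_m.+1 := snoc (a^-1 *: b) a^-1.

Let dot_point b a : 0 < a -> dot (point b a) (point b a) = (dot b b + 1) / a ^+ 2.
Proof.
move=> a0; rewrite dot_base_height base_snoc height_snoc dotZl dotZr.
by field; rewrite gt_eqF.
Qed.

(* In the hyperboloid model the hypersurface is the orthogonal complement of a
   vector N = (a, b, c), which is space-like since the hypersurface contains a
   point P; the points s P + r N and s P - r N are mirror images. *)
Lemma exists_mirror_points a b c w0 : half_space w0 ->
  (a, b) != (0, 0) ->
  a * dot w0 w0 - 2 * dot b (base w0) + c = 0 ->
  exists u v, [/\ half_space u, half_space v, u <> v &
    forall w, half_space w -> a * dot w w - 2 * dot b (base w) + c = 0 ->
      hyperbolic_dist u w = hyperbolic_dist v w].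
Proof.
move=> h0 ab0 w0E; set al := (height w0)^-1.
have al0 : 0 < al by rewrite invr_gt0.
(* Small enough for s P + r N and s P - r N both to have positive first coordinate. *)
set r := al / (1 + `|a|).
have r0 : 0 < r by rewrite divr_gt0// ltr_pwDl.
set Q := dot b b - a * c.
have Q0 : 0 <= Q.
  have -> : Q = dot (b - a *: base w0) (b - a *: base w0) + (a * height w0) ^+ 2.
    rewrite /Q (_ : c = 2 * dot b (base w0) - a * dot w0 w0); last by lra.
    by rewrite dot_base_height !dotE (dotC (base w0)); ring.
  by rewrite addr_ge0 ?dot_ge0 ?sqr_ge0.
(* [Q] is the Lorentz square of N, and N is orthogonal to P, so s^2 - r^2 Q = 1 puts both points on
   the hyperboloid. *)
set s := Num.sqrt (1 + r ^+ 2 * Q).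
have s2 : s ^+ 2 = 1 + r ^+ 2 * Q.
  by rewrite sqr_sqrtr// addr_ge0// mulr_ge0// sqr_ge0.
have s1 : 1 <= s by rewrite -sqrtr1 ler_wsqrtr// lerDl mulr_ge0// sqr_ge0.
have ra : `|r * a| < s * al.
  apply: (@lt_le_trans _ _ al); last by rewrite ler_peMl// ltW.
  rewrite normrM gtr0_norm// /r mulrAC ltr_pdivrMr; first lra.
  by rewrite ltr_pwDl.
pose A (e : R) := s * al + e * (r * a).
pose B (e : R) := (s * al) *: base w0 + (e * r) *: b.
pose u e := point (B e) (A e).
have A0 e : e ^+ 2 = 1 -> 0 < A e.
  move=> e2; have : `|e * (r * a)| < s * al.
    by rewrite normrM (_ : `|e| = 1) ?mul1r// -sqrtr_sqr e2 sqrtr1.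
  by rewrite ltr_norml /A => /andP[]; lra.
have hu e : e ^+ 2 = 1 -> half_space (u e).
  move=> e2; suff : 0 < height (u e) by [].
  by rewrite height_snoc invr_gt0 A0.
(* The third light-cone coordinate of s P + e r N, with e = 1 or -1. *)
have uu e : e ^+ 2 = 1 ->
    dot (u e) (u e) / height (u e) = s * al * dot w0 w0 + e * (r * c).
  move=> e2; have Ae := A0 e e2.
  rewrite dot_point// height_snoc invrK.
  have -> : dot (B e) (B e) + 1 = A e * (s * al * dot w0 w0 + e * (r * c)).
    have h1 : al * height w0 = 1 by rewrite mulVf// gt_eqF.
    have -> : dot (B e) (B e) + 1 = s ^+ 2 * (al ^+ 2 * dot w0 w0)
       - s ^+ 2 * (al * height w0) ^+ 2
       + 2 * s * al * e * r * dot b (base w0) + e ^+ 2 * r ^+ 2 * dot b b + 1.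
      by rewrite !dotE (dotC (base w0) b) [dot w0 w0]dot_base_height; ring.
    have -> : 2 * s * al * e * r * dot b (base w0) =
        s * al * e * r * (a * dot w0 w0 + c).
      by rewrite (_ : a * _ + c = 2 * dot b (base w0)); [ring|lra].
    have -> : dot b b = Q + a * c by rewrite /Q; ring.
    rewrite h1 e2 /A.
    have -> : s ^+ 2 * 1 ^+ 2 = 1 + r ^+ 2 * Q by rewrite s2; ring.
    have -> : (s * al + e * (r * a)) * (s * al * dot w0 w0 + e * (r * c)) =
      s ^+ 2 * (al ^+ 2 * dot w0 w0) + s * al * e * r * (a * dot w0 w0 + c) +
      e ^+ 2 * r ^+ 2 * (a * c) by ring.
    by rewrite e2; ring.
  by field; rewrite gt_eqF.
have e1 : (1 : R) ^+ 2 = 1 by rewrite expr1n.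
have eN1 : (-1 : R) ^+ 2 = 1 by rewrite sqrrN expr1n.
exists (u 1), (u (-1)); split; [exact: hu|exact: hu| |].
  move=> uv; have A1 : A 1 = A (-1).
    by apply: invr_inj; have := congr1 (@height R m.+1) uv; rewrite !height_snoc.
  have a0 : a = 0.
    have : r * a = 0 by move: A1; rewrite /A; lra.
    by move=> /eqP; rewrite mulf_eq0 gt_eqF//= => /eqP.
  have := congr1 (@base R m) uv; rewrite !base_snoc A1 => /scalerI.
  move=> /(_ (lt0r_neq0 _)); rewrite invr_gt0 A0// => /(_ isT) /addrI.
  rewrite mul1r mulN1r scaleNr => /eqP; rewrite -subr_eq0 opprK -mulr2n -scaler_nat.
  rewrite scaler_eq0 pnatr_eq0/= scaler_eq0 gt_eqF//= => /eqP b0.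
  by move: ab0; rewrite a0 b0 eqxx.
move=> w hw wE; apply/hyperbolic_dist_eq => //; [exact: hu|exact: hu|].
rewrite !uu// !height_snoc !invrK !base_snoc.
rewrite !scalerA !divff ?gt_eqF ?A0// !scale1r /A /B !dotE.
(* The two points differ by 2 r N on the hyperboloid. *)
transitivity (2 * r * (a * dot w w - 2 * dot b (base w) + c)); first by ring.
by rewrite wE mulr0.
Qed.

(* The height is chosen so that |curve t|^2 = t^(m+1) + (m+1); the constant
   m + 1 makes it positive for t in ]0, 1]. *)
Let curve (t : R) : 'rV[R]_m.+1 :=
  snoc (moments m t) (Num.sqrt (t ^+ m.+1 + m.+1%:R - dot (moments m t) (moments m t))).

Let curve_gt0 (t : R) : 0 < t <= 1 ->
  0 < t ^+ m.+1 + m.+1%:R - dot (moments m t) (moments m t).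
Proof.
move=> /andP[t0 t1]; rewrite subr_gt0.
apply: (@le_lt_trans _ _ m%:R).
  rewrite -[m in m%:R]card_ord -sumr_const; apply: ler_sum => i _.
  by rewrite !mxE -exprD exprn_ile1// ltW.
by rewrite -[ltLHS]add0r ltrD ?exprn_gt0// ltr_nat.
Qed.

Lemma kmetric_dim_hyperbolic k : (0 < k)%N ->
  kmetric_dim (@half_space R m.+1) (@hyperbolic_dist R m.+1) k = (m.+1 + k)%:R%:E.
Proof.
move=> k0; apply/eqP; rewrite eq_le; apply/andP; split; last first.
  have h0 : half_space (snoc (0 : 'rV[R]_m) 1).
    suff : 0 < height (snoc (0 : 'rV[R]_m) 1) by [].
    by rewrite height_snoc.
  apply: (kmetric_dim_ge h0) => // p hp.
  (* The [m.+1] lifted points (base, squared norm, 1) live in dimension [m.+2]. *)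
  have [z z0 zL] := exists_common_orthogonal
    (fun j : 'I_m.+1 => snoc (snoc (base (p j)) (dot (p j) (p j))) 1).
  pose a := height (base z); pose b := (- 2^-1) *: base (base z).
  have zE j : (j < m.+1)%N ->
      a * dot (p j) (p j) - 2 * dot b (base (p j)) + height z = 0.
    move=> jm; rewrite -(zL (Ordinal jm)) [in RHS](dot_base_height z).
    rewrite (dot_base_height (base z)) !base_snoc !height_snoc /b dotZl -/a.
    by field.
  have ab0 : (a, b) != (0, 0).
    apply: contra z0; rewrite xpair_eqE => /andP[/eqP a0 /eqP b0].
    have z1 : base z = 0.
      apply: base_height_inj; last by rewrite -/a a0 /height mxE.
      move/eqP: b0; rewrite scaler_eq0 oppr_eq0 invr_eq0 pnatr_eq0/= => /eqP ->.
      by apply/rowP => i; rewrite !mxE.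
    have := zE 0%N isT; rewrite a0 b0 dot0l mul0r mulr0 subrr add0r => z2.
    apply/eqP/base_height_inj; last by rewrite z2 /height mxE.
    by rewrite z1; apply/rowP => i; rewrite !mxE.
  have [u [v [hu hv uv uvE]]] := exists_mirror_points (hp 0%N) ab0 (zE 0%N isT).
  by exists u, v; split=> // j jm; apply: uvE => //; exact: zE.
(* Parameters in ]0, 1], as [curve_gt0] requires. *)
pose t (j : nat) : R := j.+1%:R^-1.
have tI : injective t by move=> i j /invr_inj/eqP; rewrite eqr_nat => /eqP[].
have t01 j : 0 < t j <= 1.
  by rewrite invr_gt0 ltr0Sn invf_le1 ?ltr0Sn// ler1n.
have base_curve j : base (curve (t j)) = moments m (t j) by exact: base_snoc.
have dot_curve j : dot (curve (t j)) (curve (t j)) = t j ^+ m.+1 + m.+1%:R.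
  rewrite dot_base_height base_curve height_snoc -expr2 sqr_sqrtr; last exact/ltW/curve_gt0.
  ring.
have h_curve j : half_space (curve (t j)).
  suff : 0 < height (curve (t j)) by [].
  by rewrite height_snoc sqrtr_gt0 curve_gt0.
apply: (@kmetric_dim_le _ _ _ _ _ _ (fun j => curve (t j))) => //.
  (* The squared norm recovers [t], even for [m = 0], when the base is empty. *)
  move=> i j e; apply: tI; have := congr1 (fun w => dot w w) e.
  rewrite /= !dot_curve => /addIr/eqP.
  have /andP[ti _] := t01 i; have /andP[tj _] := t01 j.
  by rewrite eqrXn2 ?ltW// => /eqP.
move=> u v hu hv uv I uI duv.
pose a := (height u)^-1 - (height v)^-1.
pose b := (height u)^-1 *: base u - (height v)^-1 *: base v.
pose c := dot u u / height u - dot v v / height v.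
(* The bisector equation along the curve, with |w|^2 = t^(m+1) + (m+1). If [P] vanished, [a = 0]
   would equate the heights of [u] and [v], and [b = 0] their bases. *)
pose P : {poly R} := a *: 'X^(m.+1) + ((a * m.+1%:R + c)%:P + 'X * rVpoly (- 2 *: b)).
apply: (@size_le_of_roots _ P t) => // [||j jI]; last first.
- have /hyperbolic_dist_eq := duv j jI => /(_ hu hv (h_curve j)) <-.
  rewrite dot_curve base_curve -/a -/b -/c !hornerD hornerZ hornerXn hornerC.
  by rewrite horner_moments dotZl; ring.
- rewrite (leq_trans (size_polyD _ _))// geq_max.
  rewrite (leq_trans (size_scale_leq _ _)) ?size_polyXn//=.
  by rewrite (leq_trans (size_mulX_rVpoly _ _)).
apply/eqP => P0; have a0 : a = 0.
  have := congr1 (fun q : {poly R} => q`_m.+1) P0.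
  rewrite !coefD coefZ coefXn eqxx mulr1 coef0 coefC add0r coefXM/=.
  by rewrite nth_default ?size_poly// addr0.
move: P0; rewrite /P a0 scale0r add0r => /mulX_rVpoly_eq0/eqP.
rewrite scaler_eq0 oppr_eq0 pnatr_eq0/= subr_eq0 => /eqP b0.
move/subr0_eq/invr_inj: a0 => huv; case: uv; apply: base_height_inj => //.
by move: b0; rewrite huv => /scalerI; apply; rewrite invr_eq0 gt_eqF.
Qed.

End hyperbolic_dimension.

Theorem mainTheorem5 (R : realType) (n k : nat)
  (hn : (1 <= n)%N) (hk : (1 <= k)%N) :
  [/\ kmetric_dim [set: 'rV[R]_n] (@euclidean_dist R n) k = (n + k)%:R%:E,
      kmetric_dim (@sphere R n) (@spherical_dist R n) k = (n + k)%:R%:E &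
      kmetric_dim (@half_space R n) (@hyperbolic_dist R n) k = (n + k)%:R%:E].
Proof.
split; [exact: kmetric_dim_euclidean|exact: kmetric_dim_sphere|].
by case: n hn => // m _; exact: kmetric_dim_hyperbolic.
Qed.
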